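(* Let $G=(V,E)$ be a finite simple undirected graph with $V=\{1,\ldots,N\}$, let $\gamma>0$, and consider the logistic dynamical system $$\frac{d}{dt}y_i(t)=\Big(\sum_{j\sim i}\gamma\, y_j(t)\Big)(1-y_i(t))-y_i(t),\qquad i=1,\ldots,N.$$ Let $\mathbf{y}(0)\in[0,1]^N$ be such that $y_i(0)\ge y_j(0)$ for all $i,j\in V$ with $i\succeq j$, where $\succeq$ is the preorder on $V$ defined in the context. Then the solution $\mathbf{y}(t,\mathbf{y}(0))$ with initial condition $\mathbf{y}(0)$ satisfies $$y_i(t,\mathbf{y}(0))\ge y_j(t,\mathbf{y}(0))\quad\text{for all } t\ge 0 \text{ and all } i,j\in V \text{ with } i\succeq j.$$
   Context: $\mathbb{N}=\{1,2,3,\ldots\}$; $a\sim b$ means that $a,b\in V$ are neighbors in $G$; $d(a)$ is the degree of $a$. For $\ell\in\mathbb{N}$ and $i\in V$, the set of paths (walks) of length $\ell$ departing from $i$ is $$\mathcal{P}_\ell(i)=\{(i_0,i_1,\ldots,i_\ell)\in V^{\ell+1} : i_0=i,\ i_k\sim i_{k+1}\ \text{for } 0\le k\le \ell-1\}.$$ For $0\le m\le \ell$, $\pi_{\le m}(x_0,x_1,\ldots,x_\ell)=(x_0,\ldots,x_m)$. For a vector of nodes $\mathbf{p}$, $\mathbf{d}(\mathbf{p})$ is the vector of the degrees of its entries; inequalities between vectors are componentwise. For $i,j\in V$ and $\ell\in\mathbb{N}$, a function $f^\ell_{ji}:\mathcal{P}_\ell(j)\to\mathcal{P}_\ell(i)$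 is called $\ell$-adapted at $(j,i)$ if for all $\mathbf{p},\widetilde{\mathbf{p}}\in\mathcal{P}_\ell(j)$ and all $m\le\ell$: $\pi_{\le m}(\mathbf{p})=\pi_{\le m}(\widetilde{\mathbf{p}})$ implies $\pi_{\le m}(f^\ell_{ji}(\mathbf{p}))=\pi_{\le m}(f^\ell_{ji}(\widetilde{\mathbf{p}}))$, and $\pi_{\le m}(\mathbf{p})\ne\pi_{\le m}(\widetilde{\mathbf{p}})$ implies $\pi_{\le m}(f^\ell_{ji}(\mathbf{p}))\ne\pi_{\le m}(f^\ell_{ji}(\widetilde{\mathbf{p}}))$. An adapted sequence at $(j,i)$ is a sequence $(f^\ell_{ji})_{\ell\in\mathbb{N}}$ of $\ell$-adapted functions $f^\ell_{ji}:\mathcal{P}_\ell(j)\to\mathcal{P}_\ell(i)$ such that for every $\ell\in\mathbb{N}$, $f^{\ell+1}_{ji}$ extends $f^\ell_{ji}$, i.e. for all $\mathbf{p}\in\mathcal{P}_\ell(j)$ and $\mathbf{q}\in\mathcal{P}_{\ell+1}(j)$: if $\mathbf{p}=\pi_{\le\ell}(\mathbf{q})$ then $\pi_{\le\ell}(f^{\ell+1}_{ji}(\mathbf{q}))=f^\ell_{ji}(\mathbf{p})$, and if $\mathbf{p}\ne\pi_{\le\ell}(\mathbf{q})$ then $\pi_{\le\ell}(f^{\ell+1}_{ji}(\mathbf{q}))\ne f^\ell_{ji}(\mathbf{p})$. Definition of $\succeq$: $i\succeq j$ if there exists an adapted sequence $(f^\ell_{ji})_{\ell\in\mathbb{N}}$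 at $(j,i)$ such that for all $\ell\in\mathbb{N}$, $f^\ell_{ji}$ is injective and $\mathbf{d}(f^\ell_{ji}(\mathbf{p}))\ge\mathbf{d}(\mathbf{p})$ for all $\mathbf{p}\in\mathcal{P}_\ell(j)$. *)

(* Defs.v *)
From mathcomp Require Import all_boot all_order all_algebra.
From mathcomp Require Import all_classical all_reals all_analysis.

Set Implicit Arguments.
Unset Strict Implicit.
Unset Printing Implicit Defensive.

Import Order.TTheory GRing.Theory Num.Theory.
Import numFieldNormedType.Exports.

Local Open Scope classical_set_scope.

(* A simple undirected graph on 'I_N is a symmetric irreflexive relation e;
   the definitions below do not need these two properties, so they are stated
   as hypotheses where the graph is introduced. *)

Definition deg (N : nat) (e : rel 'I_N) (a : 'I_N) : nat :=
  #|[set b : 'I_N | e a b]%SET|.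

Definition walks (N : nat) (e : rel 'I_N) (l : nat) (i : 'I_N) :
    {set l.+1.-tuple 'I_N} :=
  [set p : l.+1.-tuple 'I_N | (thead p == i) && sorted e p]%SET.

Definition walk (N : nat) (e : rel 'I_N) (l : nat) (i : 'I_N) : Type :=
  {p : l.+1.-tuple 'I_N | p \in walks e l i}.

(* The entries x_0, ..., x_m of a walk: there are m.+1 of them. *)
Definition walk_prefix (N : nat) (e : rel 'I_N) (l : nat) (i : 'I_N) (m : nat)
    (p : walk e l i) : seq 'I_N :=
  take m.+1 (val p).

Definition adapted (N : nat) (e : rel 'I_N) (l : nat) (j i : 'I_N)
    (f : walk e l j -> walk e l i) : Prop :=
  forall (p q : walk e l j) (m : nat), (m <= l)%N ->
    (walk_prefix m p = walk_prefix m q ->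
       walk_prefix m (f p) = walk_prefix m (f q)) /\
    (walk_prefix m p <> walk_prefix m q ->
       walk_prefix m (f p) <> walk_prefix m (f q)).

Definition extends (N : nat) (e : rel 'I_N) (l : nat) (j i : 'I_N)
    (g : walk e l.+1 j -> walk e l.+1 i) (f : walk e l j -> walk e l i) :
    Prop :=
  forall (p : walk e l j) (q : walk e l.+1 j),
    (val p = walk_prefix l q :> seq 'I_N ->
       walk_prefix l (g q) = val (f p) :> seq 'I_N) /\
    (val p <> walk_prefix l q :> seq 'I_N ->
       walk_prefix l (g q) <> val (f p) :> seq 'I_N).

(* Lengths start at 1.  The component f 0 of the family is unconstrained; it
   is a map between the singletons [walk e 0 j] and [walk e 0 i]. *)
Definition adapted_sequence (N : nat) (e : rel 'I_N) (j i : 'I_N)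
    (f : forall l : nat, walk e l j -> walk e l i) : Prop :=
  forall l : nat, (0 < l)%N -> adapted (f l) /\ extends (f l.+1) (f l).

(* The relation i >= j on vertices: walks from the smaller vertex j are mapped
   to walks from the larger vertex i. *)
Definition dominates (N : nat) (e : rel 'I_N) (i j : 'I_N) : Prop :=
  exists f : forall l : nat, walk e l j -> walk e l i,
    adapted_sequence f /\
    forall l : nat, (0 < l)%N ->
      injective (f l) /\
      forall (p : walk e l j) (k : 'I_l.+1),
        (deg e (tnth (val p) k) <= deg e (tnth (val (f l p)) k))%N.

Local Open Scope ring_scope.

(* A solution on [0, +oo[: continuous there, differentiable and satisfying the
   equation at every t > 0.  A solution for which the equation also holds at
   t = 0 with a one-sided derivative is in particular one in this sense. *)
Definition logistic_solution (R : realType) (N : nat) (e : rel 'I_N)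
    (gamma : R) (y0 : 'I_N -> R) (y : 'I_N -> R -> R) : Prop :=
  [/\ forall i : 'I_N, y i 0 = y0 i,
      forall i : 'I_N, {within `[0, +oo[%classic, continuous (y i)} &
      forall (i : 'I_N) (t : R), 0 < t ->
        is_derive t 1 (y i)
          ((\sum_(j < N | e i j) gamma * y j t) * (1 - y i t) - y i t)].

(* Main.v *)
Require Import Defs.
From mathcomp Require Import all_boot all_order all_algebra.
From mathcomp Require Import all_classical all_reals all_analysis.
From mathcomp Require Import ring lra.

(** The dynamics preserves the order because each step of domination is matched
    by an injection of neighbourhoods.  If i dominates j, then reading off the
    second vertex of the images of the walks from j gives a map phi, injective
    on the neighbours of j, with values in the neighbours of i, and such that
    phi k dominates k for every neighbour k of j
    ([dominates_neighbours]): an adapted sequence at (j, i), restricted to the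
    walks that start with the edge (j, k) and stripped of its first vertex, is
    an adapted sequence at (k, phi k).

    Write S_i for the sum of gamma y_k over the neighbours k of i, and
    w_ij = y_i - y_j for a pair in which i dominates j.  Then
      w_ij' = (S_i - S_j) (1 - y_i) - S_j w_ij - w_ij.
    Since y >= 0, the injection phi bounds S_i - S_j from below by the sum of
    the gamma w_(phi k, k) over the neighbours k of j, which are again
    differences along dominating pairs.  When w_ij is negative and minimal among
    all such differences this sum is at least N gamma w_ij; as 0 <= 1 - y_i <= 1,
    it follows that w_ij' >= N gamma w_ij.  A minimum principle
    ([minimum_principle]) says that a finite family of functions which satisfies
    such an inequality at its negative minima, and starts nonnegative, remains
    nonnegative.  The same principle shows that y remains in the unit cube
    ([logistic_solution_ge0], [logistic_solution_le1]), which the estimate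
    above uses. *)

Set Implicit Arguments.
Unset Strict Implicit.
Unset Printing Implicit Defensive.

Import Order.TTheory GRing.Theory Num.Theory.
Import numFieldNormedType.Exports.
Local Open Scope classical_set_scope.
Local Open Scope ring_scope.

(** * Walks *)

(** Existence is stated as a sigma type here and in the next constructions so
    that the maps between walks can be defined from it. *)
Lemma walk_of_seq N (e : rel 'I_N) l i (s : seq 'I_N) :
  size s = l.+1 -> nth i s 0 = i -> sorted e s ->
  {p : walk e l i | val p = s :> seq 'I_N}.
Proof.
move=> /eqP sz s0 ss.
have Hs : Tuple sz \in walks e l i.
  by rewrite inE /thead (tnth_nth i) /= s0 eqxx.
by exists (exist (fun p : l.+1.-tuple 'I_N => p \in walks e l i) (Tuple sz) Hs).
Qed.

Lemma walk_head N (e : rel 'I_N) l i x0 (p : walk e l i) :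
  nth x0 (val p) 0 = i.
Proof.
by case: p => p /= /[!inE]/andP[/eqP + _]; rewrite /thead (tnth_nth x0).
Qed.

Lemma walk_sorted N (e : rel 'I_N) l i (p : walk e l i) : sorted e (val p).
Proof. by case: p => p /= /[!inE]/andP[]. Qed.

Lemma walk_eq N (e : rel 'I_N) l i (p q : walk e l i) :
  val p = val q :> seq 'I_N -> p = q.
Proof. by move=> pq; apply/val_inj/val_inj. Qed.

Lemma walk_cons N (e : rel 'I_N) l j k (p : walk e l k) :
  e j k -> {q : walk e l.+1 j | val q = j :: val p :> seq 'I_N}.
Proof.
move=> ejk; apply: walk_of_seq; rewrite /= ?size_tuple //.
have := walk_head k p; have := walk_sorted p.
by case: (tval (val p)) (size_tuple (val p)) => //= x s _ -> ->; rewrite ejk.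
Qed.

Lemma walk_behead N (e : rel 'I_N) l i k (q : walk e l.+1 i) :
  nth i (val q) 1 = k ->
  e i k * {p : walk e l k | val q = i :: val p :> seq 'I_N}.
Proof.
have := walk_head i q; have := walk_sorted q.
case: (tval (val q)) (size_tuple (val q)) => [//|x [//|y s]] /= [sz].
move=> /andP[exy ys] xi yk; rewrite -{1}xi -yk; split=> //.
have [//|//|//|p pE] := @walk_of_seq N e l y (y :: s) _ _ _.
  by rewrite /= sz.
by exists p; rewrite xi pE.
Qed.

Lemma walk_take N (e : rel 'I_N) l j (q : walk e l.+1 j) :
  {p : walk e l j | val p = walk_prefix l q :> seq 'I_N}.
Proof.
apply: walk_of_seq.
- by rewrite size_takel // size_tuple.
- by rewrite nth_take // walk_head.
- by apply: take_sorted; exact: walk_sorted.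
Qed.

Lemma walk0 N (e : rel 'I_N) k : walk e 0 k.
Proof. by have [//|//|//|p _] := @walk_of_seq N e 0 k [:: k]. Qed.

Lemma walk0E N (e : rel 'I_N) k (p : walk e 0 k) : val p = [:: k] :> seq 'I_N.
Proof.
have := walk_head k p.
by case: (tval (val p)) (size_tuple (val p)) => [//|x [|//]] _ /= ->.
Qed.

(** Since f (l + 1) extends f l, truncating a walk does not change the second
    vertex of its image; after truncation to length 1 the walk is determined by
    its own second vertex, so one map phi of vertices serves all lengths. *)
Lemma adapted_sequence_second_vertex N (e : rel 'I_N) j i
    (f : forall l, walk e l j -> walk e l i) :
  adapted_sequence f ->
  exists phi : 'I_N -> 'I_N, forall k l (p : walk e l.+1 j),
    nth j (val p) 1 = k -> nth i (val (f l.+1 p)) 1 = phi k.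
Proof.
move=> fA.
suff /choice[phi phiP] : forall k, exists k', forall l (p : walk e l.+1 j),
    nth j (val p) 1 = k -> nth i (val (f l.+1 p)) 1 = k' by exists phi.
move=> k.
have [ejk|ejk] := boolP (e j k); last first.
  by exists i => l p /walk_behead[ejk']; rewrite ejk' in ejk.
have [q qE] := walk_cons (walk0 e k) ejk.
exists (nth i (val (f 1%N q)) 1); elim=> [|l IHl] p pk.
  (* There is a single walk of length 1 from j with second vertex k. *)
  congr (nth i (val (f 1%N _)) 1); apply: walk_eq.
  by have [_ [p' ->]] := walk_behead pk; rewrite qE !walk0E.
have [p' p'E] := walk_take p.
rewrite -(IHl p'); last by rewrite p'E nth_take.
have [_ /(_ p' p)[/(_ p'E) <- _]] := fA l.+1 isT.
by rewrite nth_take.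
Qed.

(** The inductive nature of domination.  The components of the sequence that
    witnesses it for (phi k, k) are p |-> behead (f (l + 1) (j :: p)); prefixes
    of length m of p and of its image correspond to prefixes of length m + 1 of
    j :: p and of its image under f, so every requirement is inherited from f.
    Injectivity of phi is that of f 1 on the edges at j. *)
Lemma dominates_neighbours N (e : rel 'I_N) i j : dominates e i j ->
  exists phi : 'I_N -> 'I_N,
    (forall k, e j k -> e i (phi k) /\ dominates e (phi k) k) /\
    {in [pred k | e j k] &, injective phi}.
Proof.
move=> [f [fA fD]].
have [phi phiP] := adapted_sequence_second_vertex fA; exists phi.
have consP k (ejk : e j k) l (p : walk e l k) :
    nth j (val (sval (walk_cons p ejk))) 1 = k.
  by rewrite (svalP (walk_cons p ejk)) /= walk_head.
split; last first.
  move=> k1 k2 /= ejk1 ejk2 phi12.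
  rewrite -(consP _ ejk1 _ (walk0 e k1)) -(consP _ ejk2 _ (walk0 e k2)).
  suff -> : sval (walk_cons (walk0 e k1) ejk1) =
            sval (walk_cons (walk0 e k2) ejk2) by [].
  have [finj _] := fD 1%N isT; apply: finj; apply: walk_eq.
  apply: (@eq_from_nth _ i); first by rewrite !size_tuple.
  move=> [|[|m]]; rewrite size_tuple // => _; first by rewrite !walk_head.
  by rewrite !(phiP _ _ _ (consP _ _ _ _)).
move=> k ejk.
(* c prepends j; g is the sequence behead \o f \o c, whose values start at
   phi k by the choice of phi. *)
pose c l (p : walk e l k) := sval (walk_cons p ejk).
have cE l (p : walk e l k) : val (c l p) = j :: val p :> seq _.
  exact: svalP (walk_cons p ejk).
pose b l (p : walk e l k) := walk_behead (phiP _ _ _ (consP _ ejk _ p)).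
pose g l (p : walk e l k) := sval (b l p).2.
have gE l (p : walk e l k) : val (f l.+1 (c l p)) = i :: val (g l p) :> seq _.
  exact: svalP (b l p).2.
have cP l m (p : walk e l k) :
    walk_prefix m.+1 (c l p) = j :: walk_prefix m p.
  by rewrite /walk_prefix cE.
have gP l m (p : walk e l k) :
    walk_prefix m.+1 (f l.+1 (c l p)) = i :: walk_prefix m (g l p).
  by rewrite /walk_prefix gE.
split; first exact: (b _ (walk0 e k)).1.
exists g; split=> l _.
  have [fad fex] := fA l.+1 isT; split.
    move=> p q m ml; have := fad (c l p) (c l q) m.+1 ml.
    rewrite !cP !gP => -[H1 H2]; split.
      by move=> pq; have [] := H1 (congr1 (cons j) pq).
    by move=> pq gpq; case: H2; [case | rewrite gpq].
  move=> p q; have := fex (c l p) (c l.+1 q).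
  rewrite !cP !gP cE gE => -[H1 H2]; split.
    by move=> pq; have [] := H1 (congr1 (cons j) pq).
  by move=> pq gpq; case: H2; [case | rewrite gpq].
have [finj fdeg] := fD l.+1 isT; split.
  move=> p q gpq; apply: walk_eq.
  have : c l p = c l q by apply: finj; apply: walk_eq; rewrite !gE gpq.
  by move=> /(congr1 (fun x => tval (val x))); rewrite !cE => -[].
move=> p m; have := fdeg (c l p) (lift ord0 m).
by rewrite !(tnth_nth i) cE gE.
Qed.

(** * A minimum principle for finite families of functions *)

Lemma is_derive_gt0_lt_left (R : realType) (f : R -> R) (c D : R) :
  is_derive c 1 f D -> 0 < D ->
  exists2 d : R, 0 < d & forall s, c - d < s -> s < c -> f s < f c.
Proof.
move=> [df fD] D0.
have H : h^-1 *: ((f \o shift c) (h *: 1) - f c) @[h --> 0^'] --> D.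
  by rewrite -fD; exact: df.
have [d /= d0 dP] := cvgr_gt D H 0 D0.
exists d => // s cs sc.
have := dP (s - c); rewrite /= sub0r normrN ltr_norml.
rewrite subr_eq0 lt_eqF //.
have -> : - d < s - c < d by apply/andP; split; lra.
rewrite [_ *: 1]mulr1 subrK => /(_ isT isT).
by rewrite /GRing.scale /= nmulr_rgt0 ?invr_lt0 ?subr_lt0.
Qed.

(** If some w a T is negative, then the damped family exp (- (K + 1) t) w a t
    attains a negative minimum over the indices and over t in [0, T], at a time
    t > 0 because the family starts nonnegative.  At that time the factor is
    common to all the indices, so w a t is itself a negative minimum over the
    indices and the assumed inequality applies; it makes the derivative of the
    damped function at least - exp (- (K + 1) t) w a t > 0.  The function is then
    smaller just before t, against minimality.  Damping by K + 1, not K, is what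
    makes this derivative strictly positive. *)
Lemma minimum_principle (R : realType) (I : finType) (P : pred I)
    (w dw : I -> R -> R) (K T : R) :
  (forall a, P a -> {within `[0, +oo[, continuous (w a)}) ->
  (forall a (t : R), P a -> 0 < t -> is_derive t 1 (w a) (dw a t)) ->
  (forall a, P a -> 0 <= w a 0) ->
  (forall a (t : R), P a -> 0 < t <= T -> w a t < 0 ->
    (forall b, P b -> w a t <= w b t) -> K * w a t <= dw a t) ->
  0 <= T -> forall a, P a -> 0 <= w a T.
Proof.
move=> wC wD w0 wK T0 a0 Pa0; rewrite leNgt; apply/negP => wa0.
pose E (t : R) := expR (- (K + 1) * t).
pose v a t := E t * w a t.
have ED (t : R) : is_derive t 1 E (E t * - (K + 1)).
  apply: (@is_derive1_comp R expR (fun t => - (K + 1) * t)).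
  have lD := is_deriveZ (- (K + 1)) (is_derive_id (t : R) (1 : R)).
  exact: is_derive_eq lD (mulr1 _).
have EC : continuous E.
  move=> t; apply: differentiable_continuous; apply/derivable1_diffP.
  by case: (ED t).
have vC a : P a -> {within `[0, T], continuous (v a)}.
  move=> Pa t; apply: cvgM.
    exact: (continuous_subspaceT EC).
  apply: (continuous_subspaceW _ (wC a Pa)).
  by apply: subset_itvl.
have : forall a, exists c, P a ->
    c \in `[0, T]%R /\ forall t, t \in `[0, T]%R -> v a c <= v a t.
  move=> a; have [Pa|] := boolP (P a); last by exists 0.
  by have [c cT cP] := EVT_min T0 (vC a Pa); exists c.
move=> /choice[c cP].
have [a Pa amin] := arg_minP (fun a => v a (c a)) Pa0.
have [cT ca] := cP a Pa.
have E0 s : 0 < E s by exact: expR_gt0.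
have TT : T \in `[0, T]%R by rewrite in_itv /= T0 lexx.
have minv b s : P b -> s \in `[0, T]%R -> v a (c a) <= v b s.
  by move=> Pb sT; apply: le_trans (amin b Pb) _; exact: (cP b Pb).2.
have vneg : v a (c a) < 0.
  by apply: le_lt_trans (minv _ _ Pa0 TT) _; rewrite /v pmulr_rlt0.
have wneg : w a (c a) < 0 by rewrite /v pmulr_rlt0 in vneg.
have c0 : 0 < c a.
  move: cT; rewrite in_itv /= => /andP[c0 _].
  rewrite lt_neqAle c0 andbT; apply/eqP => c00.
  by move: wneg; rewrite -c00 ltNge w0.
have cT' : c a <= T by move: cT; rewrite in_itv /= => /andP[].
have vD : is_derive (c a) 1 (v a)
    (E (c a) * (dw a (c a) - (K + 1) * w a (c a))).
  apply: is_derive_eq; first exact: (is_deriveM (ED (c a)) (wD a _ Pa c0)).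
  by rewrite /GRing.scale /=; ring.
have [|d d0 dP] := is_derive_gt0_lt_left vD.
  rewrite pmulr_rgt0 //; suff : K * w a (c a) <= dw a (c a) by lra.
  apply: wK => //; first by rewrite c0.
  by move=> b Pb; have := minv b _ Pb cT; rewrite ler_pM2l.
(* Any time in [0, c a[ at distance less than d from c a would do. *)
pose s := Num.max (c a / 2) (c a - d / 2).
have sc : s < c a by rewrite gt_max; apply/andP; split; lra.
have := dP s; rewrite sc lt_max; have -> : c a - d < c a - d / 2 by lra.
rewrite orbT ltNge minv //; first by move=> /(_ isT isT).
rewrite in_itv /= (le_trans (ltW sc) cT') andbT le_max.
by apply/orP; left; lra.
Qed.

(** * Bounds for sums over neighbourhoods *)

(** Since m <= 0, extending the range of summation from P to the whole of I only
    lowers the bound, which so becomes independent of P. *)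
Lemma ler_sum_npos (R : realType) (I : finType) (P : pred I) (F : I -> R)
    (m : R) :
  m <= 0 -> (forall k, P k -> m <= F k) -> #|I|%:R * m <= \sum_(k | P k) F k.
Proof.
move=> m0 mF; rewrite mulr_natl -sumr_const big_mkcond /= [leRHS]big_mkcond /=.
by apply: ler_sum => k _; case: ifPn => [/mF|].
Qed.

Lemma ler_sum_inj (R : realType) (I : finType) (P Q : pred I) (h : I -> I)
    (F : I -> R) :
  (forall k, 0 <= F k) -> (forall k, P k -> Q (h k)) -> {in P &, injective h} ->
  \sum_(k | P k) F (h k) <= \sum_(k | Q k) F k.
Proof.
move=> F0 PQ hinj.
have -> : \sum_(k | P k) F (h k) = \sum_(k in (h @: [set k | P k])%SET) F k.
  rewrite big_imset /=; first by apply: eq_bigl => k; rewrite inE.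
  by move=> k1 k2; rewrite !inE => /hinj h1 /h1.
rewrite big_mkcond /= [leRHS]big_mkcond /=; apply: ler_sum => k _.
case: ifPn => [/imsetP[k' +] ->|_]; first by rewrite inE => /PQ ->.
by case: ifP.
Qed.

(** * Invariance of the unit cube *)

(** At a negative minimum y_i one has S_i >= N gamma y_i, so
    y_i' >= N gamma y_i (1 - y_i).  This is quadratic in y_i; a lower bound - M
    of y on the compact interval [0, T] bounds 1 - y_i by 1 + M and gives the
    linear estimate with constant N gamma (1 + M). *)
Lemma logistic_solution_ge0 (R : realType) (N : nat) (e : rel 'I_N)
    (gamma : R) (y0 : 'I_N -> R) (y : 'I_N -> R -> R) (T : R) :
  0 < gamma -> (forall i, 0 <= y0 i) -> logistic_solution e gamma y0 y ->
  0 <= T -> forall i, 0 <= y i T.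
Proof.
move=> g0 y00 [yI yC yD] T0 i0.
have [M yM] : exists M, forall i t, t \in `[0, T]%R -> - M <= y i t.
  have : forall i, exists c, forall t, t \in `[0, T]%R -> y i c <= y i t.
    move=> i; have [|c _ cP] := @EVT_min R (y i) 0 T T0; last by exists c.
    by apply: (continuous_subspaceW _ (yC i)); exact: subset_itvl.
  move=> /choice[c cP]; exists (\sum_i `|y i (c i)|) => i t /(cP i).
  apply: le_trans.
  rewrite lerNl (le_trans (ler_norm _)) // normrN (bigD1 i) //= lerDl.
  by apply: sumr_ge0.
apply: (@minimum_principle R 'I_N predT y
  (fun i t => (\sum_(j < N | e i j) gamma * y j t) * (1 - y i t) - y i t)
  (N%:R * gamma * (1 + M)) T) => //.
- by move=> i _; rewrite yI.
move=> i t _ /andP[t0 tT] yneg ymin.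
have Sge : N%:R * (gamma * y i t) <= \sum_(j < N | e i j) gamma * y j t.
  rewrite -[N in N%:R]card_ord; apply: ler_sum_npos.
    by rewrite pmulr_rle0 // ltW.
  by move=> k _; rewrite ler_pM2l // ymin.
have yt : - M <= y i t by apply: yM; rewrite in_itv /= (ltW t0) tT.
have S1 : N%:R * (gamma * y i t) * (1 - y i t) <=
    (\sum_(j < N | e i j) gamma * y j t) * (1 - y i t).
  by apply: ler_wpM2r => //; lra.
have S2 : N%:R * (gamma * y i t) * (1 + M) <=
    N%:R * (gamma * y i t) * (1 - y i t).
  apply: ler_wnM2l; last by lra.
  by rewrite mulr_ge0_le0 // pmulr_rle0 // ltW.
rewrite -!mulrA (mulrC (1 + M)) !mulrA.
rewrite !mulrA in S1 S2; lra.
Qed.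

(** Where y_i > 1, both S_i (1 - y_i) and - y_i are nonpositive, so 1 - y_i is
    nondecreasing there. *)
Lemma logistic_solution_le1 (R : realType) (N : nat) (e : rel 'I_N)
    (gamma : R) (y0 : 'I_N -> R) (y : 'I_N -> R -> R) (T : R) :
  0 < gamma -> (forall i, 0 <= y0 i <= 1) -> logistic_solution e gamma y0 y ->
  0 <= T -> forall i, y i T <= 1.
Proof.
move=> g0 y01 ysol T0 i0; have [yI yC yD] := ysol.
have y_ge0 t i : 0 <= t -> 0 <= y i t.
  move=> t0; apply: logistic_solution_ge0 ysol t0 i => // i.
  by have /andP[] := y01 i.
rewrite -subr_ge0.
apply: (@minimum_principle R 'I_N predT (fun i t => 1 - y i t)
  (fun i t =>
     - ((\sum_(j < N | e i j) gamma * y j t) * (1 - y i t) - y i t)) 0 T) => //.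
- by move=> i _ t; apply: cvgB; [exact: cvg_cst|exact: yC].
- move=> i t _ t0.
  have dB := is_deriveB (is_derive_cst (1 : R) t (1 : R)) (yD i t t0).
  exact: is_derive_eq dB (sub0r _).
- by move=> i _; rewrite yI subr_ge0; have /andP[] := y01 i.
move=> i t _ /andP[t0 tT] yneg _.
rewrite mul0r oppr_ge0 subr_le0 (le_trans _ (y_ge0 t i (ltW t0))) //.
apply: mulr_ge0_le0; last exact: ltW.
by apply: sumr_ge0 => j _; rewrite mulr_ge0 ?y_ge0 // ltW.
Qed.

(** * Preservation of the order *)

Theorem theorem19 (R : realType) (N : nat) (e : rel 'I_N)
    (e_sym : symmetric e) (e_irr : irreflexive e)
    (gamma : R) (gamma_gt0 : 0 < gamma)
    (y0 : 'I_N -> R)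
    (y0_01 : forall i : 'I_N, 0 <= y0 i <= 1)
    (y0_mono : forall i j : 'I_N, dominates e i j -> y0 j <= y0 i)
    (y : 'I_N -> R -> R)
    (y_sol : logistic_solution e gamma y0 y) :
  forall (t : R) (i j : 'I_N), 0 <= t -> dominates e i j -> y j t <= y i t.
Proof.
move=> T i0 j0 T0 dij; rewrite -subr_ge0.
have [yI yC yD] := y_sol.
have y_ge0 i t : 0 <= t -> 0 <= y i t.
  move=> t0; apply: logistic_solution_ge0 y_sol t0 i => // i.
  by have /andP[] := y0_01 i.
have y_le1 i t : 0 <= t -> y i t <= 1.
  by move=> t0; exact: logistic_solution_le1 y_sol t0 i.
pose S i t := \sum_(j < N | e i j) gamma * y j t.
pose dy i t := S i t * (1 - y i t) - y i t.
apply: (@minimum_principle R ('I_N * 'I_N)%type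
  (fun p => `[< dominates e p.1 p.2 >])
  (fun p t => y p.1 t - y p.2 t) (fun p t => dy p.1 t - dy p.2 t)
  (N%:R * gamma) T _ _ _ _ T0 (i0, j0)); last exact/asboolP.
- by move=> p _ t; apply: cvgB; exact: yC.
- by move=> p t _ t0; apply: is_deriveB; exact: yD.
- by move=> p /asboolP /y0_mono; rewrite !yI subr_ge0.
move=> [i j] t /asboolP /= ij /andP[/ltW t0 tT] wneg wmin.
have [phi [phiP phi_inj]] := dominates_neighbours ij.
have SS : N%:R * (gamma * (y i t - y j t)) <= S i t - S j t.
  have gy k : 0 <= gamma * y k t by rewrite mulr_ge0 ?y_ge0 // ltW.
  have phiS :
      \sum_(k | e j k) gamma * y (phi k) t - S j t <= S i t - S j t.
    rewrite lerD2r; apply: (ler_sum_inj gy) => // k ejk.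
    exact: (phiP k ejk).1.
  apply: le_trans phiS; rewrite /S -sumrB.
  rewrite -[N in N%:R]card_ord; apply: ler_sum_npos.
    by rewrite pmulr_rle0 // ltW.
  move=> k /phiP[_ /asboolP kk]; rewrite -mulrBr ler_pM2l //.
  exact: wmin (phi k, k) kk.
have Sj : 0 <= S j t.
  by apply: sumr_ge0 => k _; rewrite mulr_ge0 ?y_ge0 // ltW.
have -> : dy i t - dy j t = (S i t - S j t) * (1 - y i t)
    - S j t * (y i t - y j t) - (y i t - y j t) by rewrite /dy; ring.
have yi0 := y_ge0 i t t0; have yi1 := y_le1 i t t0.
have H1 : N%:R * (gamma * (y i t - y j t)) * (1 - y i t) <=
    (S i t - S j t) * (1 - y i t) by apply: ler_wpM2r => //; lra.
have H2 : N%:R * (gamma * (y i t - y j t)) <=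
    N%:R * (gamma * (y i t - y j t)) * (1 - y i t).
  apply: ler_niMr; last by lra.
  by rewrite mulr_ge0_le0 // pmulr_rle0 // ltW.
have H3 : S j t * (y i t - y j t) <= 0 by rewrite mulr_ge0_le0 // ltW.
rewrite -mulrA; lra.
Qed.
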